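(* There exists a packing $\mathcal{P}$ of $\mathbb{R}^3$ by congruent regular tetrahedra such that the following hold. (1) $\mathcal{P}$ is periodic and has packing fraction $\frac{139+40\sqrt{10}}{369}$. (2) Each primitive unit cell of the lattice of translations of $\mathcal{P}$ contains two tetrahedra. (3) The group of all isometries of $\mathbb{R}^3$ leaving $\mathcal{P}$ invariant is a crystallographic space group of type $P\bar{1}$, and it acts transitively on the individual tetrahedra of $\mathcal{P}$.
   Context: A packing by congruent regular tetrahedra is a collection $\mathcal{P}$ of solid regular tetrahedra in $\mathbb{R}^3$, all congruent to one another, with pairwise disjoint interiors (tetrahedra may touch along their boundaries). An isometry $g$ of $\mathbb{R}^3$ leaves $\mathcal{P}$ invariant if $T\mapsto g(T)$ is a bijection of $\mathcal{P}$ onto itself. The packing is periodic if the set $\Lambda$ of vectors $v\in\mathbb{R}^3$ such that translation by $v$ leaves $\mathcal{P}$ invariant is a lattice of rank 3 and $\Lambda$ has finitely many orbits on $\mathcal{P}$. Then $\Lambda$ is called the lattice of translations of $\mathcal{P}$, and the phrase ''a unit cell contains $N$ tetrahedra'' means that there are exactly $N$ orbits of tetrahedra under $\Lambda$, with ''unit cell'' meaning primitive unit cell. The packing fraction of a periodic packing with $N$ tetrahedra per primitive unit cell, each of volume $V$, is $NV/\operatorname{covol}(\Lambda)$, where $\operatorname{covol}(\Lambda)$ is the absolute value of the determinant of a basis of $\Lambda$. A space group of type $P\bar{1}$ (number 2 in the International Tables) is a group of isometries of $\mathbb{R}^3$ generated by the translations by the vectors of a rank-3 lattice together with the inversion $p\mapsto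 2o-p$ about some point $o\in\mathbb{R}^3$. *)

(* Defs.v *)
From HB Require Import structures.
From mathcomp Require Export all_boot all_order all_algebra.
From mathcomp Require Export all_classical all_reals all_analysis.
Export Order.TTheory GRing.Theory Num.Theory.
Export numFieldNormedType.Exports.

#[export] Set Implicit Arguments.
#[export] Unset Strict Implicit.
#[export] Unset Printing Implicit Defensive.

Local Open Scope classical_set_scope.
Local Open Scope ring_scope.

Section Packings.
Context {R : realType}.
Local Notation E3 := 'rV[R]_3.

(* The library's norm on row vectors is the sup norm, which induces the same
   topology but not the same isometries. *)
Definition edist (x y : E3) : R := Num.sqrt (\sum_(i < 3) (x 0 i - y 0 i) ^+ 2).

(* Surjectivity is automatic in finite dimension. *)
Definition isometry (g : E3 -> E3) : Prop :=
  forall x y, edist (g x) (g y) = edist x y.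

Definition congruent (A B : set E3) : Prop :=
  exists2 g, isometry g & B = g @` A.

Definition solid_tetrahedron (v : 'I_4 -> E3) : set E3 :=
  [set x | exists w : 'I_4 -> R,
     [/\ forall i, 0 <= w i, \sum_i w i = 1 & x = \sum_i w i *: v i]].

Definition regular_tetrahedron (T : set E3) : Prop :=
  exists (v : 'I_4 -> E3) (a : R),
    [/\ 0 < a, forall i j, i != j -> edist (v i) (v j) = a
      & T = solid_tetrahedron v].

Definition tetrahedron_packing (P : set (set E3)) : Prop :=
  [/\ forall T, P T -> regular_tetrahedron T,
      forall T T', P T -> P T' -> congruent T T'
    & forall T T', P T -> P T' -> T <> T' -> interior T `&` interior T' = set0].

Definition leaves_invariant (g : E3 -> E3) (P : set (set E3)) : Prop :=
  set_bij P P (fun T => g @` T).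

Definition symmetry_group (P : set (set E3)) : set (E3 -> E3) :=
  [set g | isometry g /\ leaves_invariant g P].

Definition translation (v : E3) : E3 -> E3 := fun x => x + v.

Definition translations (P : set (set E3)) : set E3 :=
  [set v | leaves_invariant (translation v) P].

(* The rows of B are the basis vectors. *)
Definition lattice_basis (B : 'M[R]_3) (L : set E3) : Prop :=
  B \in unitmx /\ L = [set \sum_i (z i)%:~R *: row i B | z in [set: 'I_3 -> int]].

Definition lattice (L : set E3) : Prop := exists B, lattice_basis B L.

Definition translation_orbits (P : set (set E3)) : set (set (set E3)) :=
  [set [set translation v @` T | v in translations P] | T in P].

Definition periodic (P : set (set E3)) : Prop :=
  lattice (translations P) /\ finite_set (translation_orbits P).

Definition unit_cell_contains (P : set (set E3)) (N : nat) : Prop :=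
  (translation_orbits P #= `I_N)%card.

Definition volume (A : set E3) : \bar R :=
  ((@lebesgue_measure R \x @lebesgue_measure R) \x @lebesgue_measure R)%E
    [set p | A (\row_i [:: p.1.1; p.1.2; p.2]`_i)].

(* N, V and `|\det B| are determined by P when P is periodic and nonempty. *)
Definition packing_fraction (P : set (set E3)) (phi : R) : Prop :=
  exists (N : nat) (V : R) (B : 'M[R]_3),
    [/\ unit_cell_contains P N,
        forall T, P T -> volume T = V%:E,
        lattice_basis B (translations P)
      & phi = N%:R * V / `|\det B|].

Definition inversion (o : E3) : E3 -> E3 := fun p => 2 *: o - p.

Definition isometry_group (G : set (E3 -> E3)) : Prop :=
  [/\ forall g, G g -> isometry g,
      G id,
      forall g h, G g -> G h -> G (g \o h)
    & forall g, G g -> exists2 h, G h & cancel g h /\ cancel h g].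

(* "smallest isometry_group S" is the group of isometries generated by S. *)
Definition space_group_P1bar (G : set (E3 -> E3)) : Prop :=
  exists (L : set E3) (o : E3),
    lattice L /\
    G = smallest isometry_group (translation @` L `|` [set inversion o]).

Definition acts_transitively (G : set (E3 -> E3)) (P : set (set E3)) : Prop :=
  forall T T', P T -> P T' -> exists2 g, G g & g @` T = T'.

End Packings.

(* Main.v *)
From HB Require Import structures.
Require Import Defs.
From mathcomp Require Import measurable_realfun ring lra zify.
Local Open Scope classical_set_scope.
Local Open Scope ring_scope.

(** A regular tetrahedron of edge [2 * sqrt 2] is inscribed in a cube of side 2.
    Fix one centred at the origin, together with its mirror image under
    [x |-> - x]; the packing consists of the translates of the former by a
    lattice and of the latter by the same lattice moved by a vector [shift].
    In cube coordinates the basis of the lattice has the rows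
      [(2, - q, 0)], [(- r, 2, - s)], [(- s, - r, 2)], and
      [shift = (s, r + s, - s)].
    With [q = s - r] and [r + 3 * s = 2] every tetrahedron touches neighbours in
    fourteen lattice directions and five neighbours of the opposite orientation;
    this leaves one free parameter, and [r = 2 * sqrt 10 - 6] is a critical
    point of the covolume, which is then [16 * (139 - 40 * sqrt 10) / 27].  Two
    tetrahedra of volume [8 / 3] per cell give the density, because
    [(139 - 40 * sqrt 10) * (139 + 40 * sqrt 10) = 9 * 369].

    Interiors.  Two tetrahedra of the same orientation are separated by a
    plane parallel to a face of the cube or of the tetrahedron [T] as soon as the
    difference of their centres leaves the open cuboctahedron [T - T]; for
    opposite orientations it has to leave the open tetrahedron [2 * T].  Both
    bodies lie in a cube of side 4, and the basis is so close to twice the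
    identity that a handful of lattice vectors are left to examine
    ([short_latpt_eq0], [latpt_shift_separated]).

    Symmetries.  The maps [x |-> v + x] and [x |-> v - x] with [v] in the
    appropriate coset form a group generated by the lattice translations and
    one inversion, and the packing is the orbit of one tetrahedron under it.
    Conversely, an isometry preserving the packing sends a tetrahedron to a
    tetrahedron, vertices to vertices, so that its linear part permutes the four
    vertex directions up to a global sign.  It also preserves the lattice, and
    the only lattice vectors to which it can send the sum of the first two basis
    vectors are this sum and its opposite; as its four inner products with the
    vertex directions have distinct absolute values, the permutation is trivial
    ([symmetry_motion]).

    Volume.  A vertical line meets the tetrahedron in a segment as long as the
    one in which it meets a square pyramid standing over the shadow of the tetrahedron,
    whose horizontal sections are squares ([volume_tet]). *)

(** * Regular tetrahedra inscribed in cubes *)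

Section Tetrahedra.
Context {R : realType}.
Local Notation E3 := 'rV[R]_3.
Implicit Types (x y w : E3) (b : bool).

Definition vec (a b c : R) : E3 := \row_i [:: a; b; c]`_i.

Definition dot x y : R := \sum_(i < 3) x 0 i * y 0 i.

Lemma vecP x y : x 0 0 = y 0 0 -> x 0 1 = y 0 1 -> x 0 2%:R = y 0 2%:R -> x = y.
Proof.
move=> e0 e1 e2; apply/rowP => -[[|[|[|//]]] h].
- by have -> : Ordinal h = 0 by exact/val_inj.
- by have -> : Ordinal h = 1 by exact/val_inj.
- by have -> : Ordinal h = 2%:R by exact/val_inj.
Qed.

Lemma forall_ord4 (Q : 'I_4 -> Prop) :
  (forall i, Q i) <-> [/\ Q 0, Q 1, Q 2%:R & Q 3%:R].
Proof.
split=> [Qi | [Q0 Q1 Q2 Q3] [[|[|[|[|//]]]] h]]; first by split; exact: Qi.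
- by have -> : Ordinal h = 0 by exact/val_inj.
- by have -> : Ordinal h = 1 by exact/val_inj.
- by have -> : Ordinal h = 2%:R by exact/val_inj.
- by have -> : Ordinal h = 3%:R by exact/val_inj.
Qed.

Lemma sum_ord3 (V : zmodType) (F : 'I_3 -> V) : \sum_i F i = F 0 + F 1 + F 2%:R.
Proof.
rewrite !big_ord_recl big_ord0 addr0 addrA.
by congr (_ + F _ + F _); exact/val_inj.
Qed.

Lemma sum_ord4 (V : zmodType) (F : 'I_4 -> V) :
  \sum_i F i = F 0 + F 1 + F 2%:R + F 3%:R.
Proof.
rewrite !big_ord_recl big_ord0 addr0 !addrA.
by congr (_ + F _ + F _ + F _); exact/val_inj.
Qed.

Definition vtx (i : 'I_4) : E3 :=
  [:: vec 1 1 1; vec 1 (-1) (-1); vec (-1) 1 (-1); vec (-1) (-1) 1]`_i.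

Lemma dotE x y : dot x y = x 0 0 * y 0 0 + x 0 1 * y 0 1 + x 0 2%:R * y 0 2%:R.
Proof. exact: sum_ord3. Qed.

Lemma dotC x y : dot x y = dot y x.
Proof. by rewrite !dotE; ring. Qed.

Definition coordE := (dotE, sum_ord3, sum_ord4, mxE).

(** The four inequalities bound the faces: the outward normals of the reference
    tetrahedron are the opposites of its vertices.  The boolean [b] tells
    whether the orientation is reversed. *)
Definition tet b w : set E3 :=
  [set x | forall i, -1 <= (-1) ^+ b * dot (vtx i) (x - w)].

Definition corner b w (i : 'I_4) : E3 := w + (-1) ^+ b *: vtx i.

Lemma dot_vtx i j : dot (vtx i) (vtx j) = if i == j then 3 else -1.
Proof.
move: i; apply/forall_ord4; split; move: j; apply/forall_ord4; split;
rewrite !coordE /=; ring.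
Qed.

Lemma sum_dot_vtx x : \sum_i dot (vtx i) x = 0.
Proof. by rewrite !coordE /=; ring. Qed.

Lemma sum_vtx : \sum_i vtx i = 0.
Proof. by apply: vecP; rewrite !coordE /=; ring. Qed.

(** The vertex directions form a tight frame; this turns barycentric coordinates
    into Euclidean distances. *)
Lemma sum_dot_vtx_sqr x : \sum_i dot (vtx i) x ^+ 2 = 4 * dot x x.
Proof. by rewrite !coordE /=; ring. Qed.

Lemma dotDr x y z : dot x (y + z) = dot x y + dot x z.
Proof. by rewrite !coordE; ring. Qed.

Lemma dotNr x y : dot x (- y) = - dot x y.
Proof. by rewrite !coordE; ring. Qed.

Lemma dotZr x a y : dot x (a *: y) = a * dot x y.
Proof. by rewrite !coordE; ring. Qed.

Lemma dot0r x : dot x 0 = 0.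
Proof. by rewrite !coordE; ring. Qed.

Lemma dot_vtx_inj x y : (forall i, dot (vtx i) x = dot (vtx i) y) -> x = y.
Proof.
by case/forall_ord4; rewrite !coordE /= => *; apply: vecP; lra.
Qed.

(** Opposite edges of the tetrahedron are diagonals of opposite faces of the cube,
    so the sum of two vertices points along a coordinate axis. *)
Lemma coord_dot_vtx x (k : 'I_3) :
  exists i, i != 0 /\ 2 * x 0 k = dot (vtx 0) x + dot (vtx i) x.
Proof.
case: k => -[|[|[|//]]] h.
- have -> : Ordinal h = 0 by exact/val_inj.
  by exists 1; split=> //; rewrite !coordE /=; ring.
- have -> : Ordinal h = 1 by exact/val_inj.
  by exists 2%:R; split=> //; rewrite !coordE /=; ring.
- have -> : Ordinal h = 2%:R by exact/val_inj.
  by exists 3%:R; split=> //; rewrite !coordE /=; ring.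
Qed.

Lemma vtx_neq0 i : vtx i != 0 :> E3.
Proof.
apply/eqP => e; have := dot_vtx i i; rewrite {2}e dot0r eqxx => /eqP.
by rewrite eq_sym pnatr_eq0.
Qed.

Lemma dot_corner b w w' i j : dot (vtx i) (corner b w j - w') =
  dot (vtx i) (w - w') + (-1) ^+ b * (if i == j then 3 else -1).
Proof. by rewrite /corner [_ + _ - w']addrAC [LHS]dotDr dotZr dot_vtx. Qed.

Lemma tet_corner b w i : tet b w (corner b w i).
Proof.
move=> j; rewrite dot_corner subrr dot0r.
by case: b; case: eqP => _ /=; lra.
Qed.

Lemma tetE b w : tet b w = solid_tetrahedron (corner b w).
Proof.
apply/seteqP; split=> x.
  move=> hx; exists (fun i => (1 + (-1) ^+ b * dot (vtx i) (x - w)) / 4).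
  split.
  - by move=> i; have := hx i; lra.
  - by rewrite !coordE /=; lra.
  - apply: vecP; rewrite !coordE /=; case: b {hx} => /=; lra.
case=> k [k0 k1 ->]; move: k1; rewrite sum_ord4 => k1.
have k1' : k 0 = 1 - k 1 - k 2%:R - k 3%:R by lra.
have [] := (forall_ord4 _).1 k0; rewrite k1' => q0 q1 q2 q3.
apply/forall_ord4; split; rewrite !coordE; rewrite ?k1'; case: b => /=; lra.
Qed.

Definition sqn x := dot x x.

Lemma edistE x y : edist x y = Num.sqrt (sqn (x - y)).
Proof. by rewrite /edist /sqn !coordE; congr Num.sqrt; ring. Qed.

Lemma sqn_ge0 x : 0 <= sqn x.
Proof. by rewrite /sqn dotE -!expr2 !addr_ge0 ?sqr_ge0. Qed.

Lemma sqn_eq0 x : sqn x = 0 -> x = 0.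
Proof.
rewrite /sqn dotE => e; move: (sqr_ge0 (x 0 0)) (sqr_ge0 (x 0 1)) (sqr_ge0 (x 0 2%:R)).
by move=> h0 h1 h2; apply: vecP; rewrite mxE; apply/eqP; rewrite -sqrf_eq0; apply/eqP; lra.
Qed.

Lemma isometryP (g : E3 -> E3) :
  isometry g <-> forall x y, sqn (g x - g y) = sqn (x - y).
Proof.
rewrite /isometry; split=> h x y; last by rewrite !edistE h.
by have := h x y; rewrite !edistE => /eqP; rewrite eqr_sqrt ?sqn_ge0// => /eqP.
Qed.

Lemma sqn_corner b w i j : i != j -> sqn (corner b w i - corner b w j) = 8.
Proof.
move=> ij; have -> : corner b w i - corner b w j = (-1) ^+ b *: (vtx i - vtx j).
  by rewrite /corner opprD addrACA subrr add0r scalerBr.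
rewrite /sqn dotZr (dotC (_ *: _)) dotZr mulrA -expr2 sqrr_sign mul1r dotDr dotNr.
rewrite !(dotC (vtx i - _)) !dotDr !dotNr !dot_vtx !eqxx.
by rewrite [j == i]eq_sym (negPf ij); ring.
Qed.

Lemma tet_regular b w : regular_tetrahedron (tet b w).
Proof.
exists (corner b w), (Num.sqrt 8); split; last exact: tetE.
- by rewrite sqrtr_gt0.
- by move=> i j ij; rewrite edistE sqn_corner.
Qed.

(** The centre and the orientation can be read off from the corners alone: since
    the four numbers [dot (vtx i) (w - w')] add up to zero, one-sided bounds on
    them suffice, both to exclude opposite orientations and to make [w - w']
    vanish. *)
Lemma tet_corner_inj b w b' w' :
  (forall i, tet b' w' (corner b w i)) -> b = b' /\ w = w'.
Proof.
move=> h; have := sum_dot_vtx (w - w'); rewrite sum_ord4 => s0.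
have {h}h i j : -1 <= (-1) ^+ b' * (dot (vtx j) (w - w')
    + (-1) ^+ b * (if j == i then 3 else -1)) by rewrite -dot_corner; exact: h.
have eb : b = b'.
  have := (h 0 0, h 1 1, h 2%:R 2%:R, h 3%:R 3%:R); rewrite !eqxx.
  by case: b b' {h} => -[] //= -[[[]]]; lra.
split=> //; apply: dot_vtx_inj => i; apply/eqP; rewrite -subr_eq0 -dotNr -dotDr.
move: (h 1 0) (h 0 1) (h 0 2%:R) (h 0 3%:R); rewrite -eb /= => h0 h1 h2 h3.
by apply/eqP; move: i; apply/forall_ord4; split; case: b h0 h1 h2 h3 {h eb} => /=; lra.
Qed.

Lemma tet_inj b w b' w' : tet b w = tet b' w' -> b = b' /\ w = w'.
Proof. by move=> e; apply: tet_corner_inj => i; rewrite -e; exact: tet_corner. Qed.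

(** Two points of the standard simplex are at squared distance at most 2, with
    equality only between vertices: writing [a] and [b] for the two points, the
    squared distance is 2 minus twice their inner product and twice the products
    of distinct coordinates of [a] and of [b], all of which are nonnegative. *)
Lemma simplex_diameter (a b : 'I_4 -> R) :
  (forall i, 0 <= a i) -> (forall i, 0 <= b i) ->
  \sum_i a i = 1 -> \sum_i b i = 1 -> 2 <= \sum_i (a i - b i) ^+ 2 ->
  exists i, forall j, a j = (i == j)%:R.
Proof.
move=> /forall_ord4[a0 a1 a2 a3] /forall_ord4[b0 b1 b2 b3].
rewrite !sum_ord4 => sa sb sq.
have pos (x y : R) : 0 <= x -> 0 <= y -> 0 <= x * y by exact: mulr_ge0.
move: (pos _ _ a0 b0) (pos _ _ a1 b1) (pos _ _ a2 b2) (pos _ _ a3 b3).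
move: (pos _ _ a0 a1) (pos _ _ a0 a2) (pos _ _ a0 a3) (pos _ _ a1 a2).
move: (pos _ _ a1 a3) (pos _ _ a2 a3).
move: (pos _ _ b0 b1) (pos _ _ b0 b2) (pos _ _ b0 b3) (pos _ _ b1 b2).
move: (pos _ _ b1 b3) (pos _ _ b2 b3) => *.
have ea : (a 0 + a 1 + a 2%:R + a 3%:R) ^+ 2 = 1 by rewrite sa expr1n.
have eb : (b 0 + b 1 + b 2%:R + b 3%:R) ^+ 2 = 1 by rewrite sb expr1n.
have z01 : a 0 * a 1 = 0 by lra.
have z02 : a 0 * a 2%:R = 0 by lra.
have z03 : a 0 * a 3%:R = 0 by lra.
have z12 : a 1 * a 2%:R = 0 by lra.
have z13 : a 1 * a 3%:R = 0 by lra.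
have z23 : a 2%:R * a 3%:R = 0 by lra.
have [n0|] := eqVneq (a 0) 0; last first.
  move=> n; exists 0; apply/forall_ord4; move/eqP: z01; move/eqP: z02; move/eqP: z03.
  rewrite !mulf_eq0 (negPf n) /= => /eqP e1 /eqP e2 /eqP e3.
  by split=> //=; lra.
have [n1|] := eqVneq (a 1) 0; last first.
  move=> n; exists 1; apply/forall_ord4; move/eqP: z12; move/eqP: z13.
  rewrite !mulf_eq0 (negPf n) /= => /eqP e1 /eqP e2.
  by split=> //=; lra.
have [n2|] := eqVneq (a 2%:R) 0; last first.
  move=> n; exists 2%:R; apply/forall_ord4; move/eqP: z23.
  rewrite !mulf_eq0 (negPf n) /= => /eqP e1.
  by split=> //=; lra.
by exists 3%:R; apply/forall_ord4; split=> //=; lra.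
Qed.

(** The edge length is the diameter, attained at vertices only.  Hence isometries
    map corners to corners, without any discussion of extreme points. *)
Lemma tet_diameter b w x y : tet b w x -> tet b w y -> 8 <= sqn (x - y) ->
  exists i, x = corner b w i.
Proof.
move=> hx hy xy.
pose bary z i := (1 + (-1) ^+ b * dot (vtx i) (z - w)) / 4.
have bary_ge0 z : tet b w z -> forall i, 0 <= bary z i.
  by move=> hz i; have := hz i; rewrite /bary; lra.
have sum_bary z : \sum_i bary z i = 1.
  by have := sum_dot_vtx (z - w); rewrite /bary !sum_ord4; case: (b) => /=; lra.
have [i hi] : exists i, forall j, bary x j = (i == j)%:R.
  apply: (@simplex_diameter _ (bary y)); rewrite ?sum_bary//; try exact: bary_ge0.
  have -> : \sum_i (bary x i - bary y i) ^+ 2 = \sum_i dot (vtx i) (x - y) ^+ 2 / 16.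
    apply: eq_bigr => i _; rewrite /bary !dotDr !dotNr.
    by case: (b) => /=; field.
  by rewrite -mulr_suml sum_dot_vtx_sqr -/(sqn _); lra.
exists i; apply: dot_vtx_inj => j.
have := hi j; have := dot_corner b w w j i; rewrite /bary !(dotDr, dotNr) eq_sym.
by case: (i == j); case: (b) => /=; lra.
Qed.

Lemma tet_slab_vtx b w i x : tet b w x ->
  -1 <= (-1) ^+ b * (dot (vtx i) x - dot (vtx i) w) <= 3.
Proof.
move=> /forall_ord4[h0 h1 h2 h3]; have := sum_dot_vtx (x - w).
move: h0 h1 h2 h3; rewrite sum_ord4 -dotNr -dotDr.
move: i; apply/forall_ord4; split; case: b => /= h0 h1 h2 h3 s; apply/andP; split; lra.
Qed.

Lemma tet_slab_axis b w (k : 'I_3) x : tet b w x -> `|x 0 k - w 0 k| <= 1.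
Proof.
move=> xT; have [i [i0]] := coord_dot_vtx (x - w) k.
have /forall_ord4[h0 h1 h2 h3] := xT; have := sum_dot_vtx (x - w).
rewrite sum_ord4 !mxE ler_norml; move: i i0 h0 h1 h2 h3.
by apply/forall_ord4; split => //; case: (b) => /= _ h0 h1 h2 h3 s e; apply/andP; split; lra.
Qed.

(** A point common to both interiors would lie on the separating plane; moving it
    along the normal [a] leaves the first set at once. *)
Lemma interior_separated (a : E3) (k : R) (A A' : set E3) : a != 0 ->
  (forall x, A x -> dot a x <= k) -> (forall x, A' x -> k <= dot a x) ->
  interior A `&` interior A' = set0.
Proof.
move=> a0 hA hA'; apply/seteqP; split=> // x [xA /interior_subset/hA' xA'].
have : \forall t \near (0 : R)^'+, A (x + t *: a).
  have ct : x + t *: a @[t --> (0:R)^'+] --> x + 0 *: a.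
    apply: cvgD; first exact: cvg_cst.
    by apply: cvgZr_tmp; exact: cvg_at_right_filter.
  by rewrite scale0r addr0 in ct; exact: ct.
move=> h; near (0 : R)^'+ => t.
have t0 : 0 < t by near: t; exact: nbhs_right_gt.
have : A (x + t *: a) by near: t.
move/hA.
have -> : dot a (x + t *: a) = dot a x + t * sqn a by rewrite /sqn !coordE; ring.
suff : 0 < t * sqn a by lra.
rewrite mulr_gt0// lt0r sqn_ge0 andbT.
by apply: contra a0 => /eqP/sqn_eq0 ->.
Unshelve. all: by end_near.
Qed.

(** The two alternatives are the two kinds of facets of the cuboctahedron
    [T - T]: squares, where two edges meet, and triangles, where a
    vertex meets a face. *)
Lemma same_orientation_disjoint b w w' :
  (exists k, 2 <= `|(w' - w) 0 k|) \/ (exists i, 4 <= `|dot (vtx i) (w' - w)|) ->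
  interior (tet b w) `&` interior (tet b w') = set0.
Proof.
wlog: w w' / (exists k, 2 <= (w' - w) 0 k) \/ (exists i, 4 <= dot (vtx i) (w' - w)).
  move=> wl h.
  have : ((exists k, 2 <= (w' - w) 0 k) \/ (exists i, 4 <= dot (vtx i) (w' - w))) \/
      ((exists k, 2 <= (w - w') 0 k) \/ (exists i, 4 <= dot (vtx i) (w - w'))).
    case: h => -[j]; rewrite ler_normr => /orP[h|h].
    - by left; left; exists j.
    - by right; left; exists j; move: h; rewrite !mxE opprB.
    - by left; right; exists j.
    - by right; right; exists j; move: h; rewrite -dotNr opprB.
  case=> h'; first exact: wl.
  rewrite setIC; apply: wl => //; rewrite -(opprB w' w).
  case: h => -[j h]; [left|right]; exists j; last by rewrite dotNr normrN.
  by rewrite mxE normrN.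
case=> -[j]; rewrite ?mxE ?dotDr ?dotNr => h _.
- have dk x : dot (delta_mx 0 j) x = x 0 j.
    rewrite /dot (bigD1 j)//= big1 ?addr0 => [|i ij]; rewrite mxE ?eqxx ?mul1r//.
    by rewrite (negPf ij) andbF mul0r.
  apply: (interior_separated (a := delta_mx 0 j) (k := w 0 j + 1)).
  + by apply/eqP => /matrixP/(_ 0 j)/eqP; rewrite !mxE !eqxx oner_eq0.
  + by move=> x /(@tet_slab_axis _ _ j); rewrite dk ler_norml => /andP[*]; lra.
  + by move=> x /(@tet_slab_axis _ _ j); rewrite dk ler_norml => /andP[*]; lra.
- apply: (interior_separated (a := vtx j)
    (k := dot (vtx j) w + (if b then 1 else 3))); first exact: vtx_neq0.
  + by move=> x /(@tet_slab_vtx _ _ j)/andP[]; case: (b) => /= *; lra.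
  + by move=> x /(@tet_slab_vtx _ _ j)/andP[]; case: (b) => /= *; lra.
Qed.

Lemma opposite_orientation_disjoint w w' :
  (exists i, dot (vtx i) (w' - w) <= -2) ->
  interior (tet false w) `&` interior (tet true w') = set0.
Proof.
case=> i; rewrite dotDr dotNr => h; rewrite setIC.
apply: (interior_separated (a := vtx i) (k := dot (vtx i) w - 1)); first exact: vtx_neq0.
- by move=> x /(@tet_slab_vtx _ _ i)/andP[] /= *; lra.
- by move=> x /(@tet_slab_vtx _ _ i)/andP[] /= *; lra.
Qed.

End Tetrahedra.

(** * The volume of a tetrahedron *)

Section Volume.
Context {R : realType}.
Local Notation E3 := 'rV[R]_3.
Local Notation mu := (@lebesgue_measure R).
Implicit Types (w : E3) (b : bool).

Lemma square_diagonals (X Y k : R) :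
  (`|X + Y| + `|X - Y| <= k) = (`|2 * X| <= k) && (`|2 * Y| <= k).
Proof.
apply/idP/andP; rewrite !ler_norml; case: (ger0P (X + Y)) => ?; case: (ger0P (X - Y)) => ?;
  try move=> [/andP[? ?] /andP[? ?]]; try move=> ?; by repeat (try apply/andP; split); lra.
Qed.

Lemma integral_square : (\int[mu]_(t in `[0%R, 2%R]) ((2 - t) ^+ 2)%:E = (8 / 3)%:E)%E.
Proof.
pose F (t : R) := - (2 - t) ^+ 3 / 3.
have cF : continuous F by move=> t; apply: differentiable_continuous.
rewrite (@continuous_FTC2 _ _ F).
- by rewrite -EFinB; congr EFin; rewrite /F; field.
- by [].
- by apply: continuous_subspaceT => t; apply: differentiable_continuous.
- split.
  + by move=> t _; exact: ex_derive.
  + by apply: cvg_at_right_filter; exact: cF.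
  + by apply: cvg_at_left_filter; exact: cF.
- move=> t _; rewrite derive1E derive_val.
  by rewrite /GRing.scale /=; field.
Qed.

(** The pyramid below is easier to slice along the last factor, whereas the
    product measure is defined by slicing along the first. *)
Lemma product_measure_ysection d1 d2 (T1 : measurableType d1) (T2 : measurableType d2)
    (m1 : {sigma_finite_measure set T1 -> \bar R})
    (m2 : {sigma_finite_measure set T2 -> \bar R}) (A : set (T1 * T2)) :
  measurable A -> ((m1 \x m2) A = \int[m2]_y m1 (ysection A y))%E.
Proof.
move=> mA; rewrite -[RHS]/((m1 \x^ m2)%E A).
by apply: product_measure_unique => // A1 A2 mA1 mA2; exact: product_measure2E.
Qed.

Lemma product_measure_xsection d1 d2 (T1 : measurableType d1) (T2 : measurableType d2)
    (m1 : {measure set T1 -> \bar R})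
    (m2 : {sigma_finite_measure set T2 -> \bar R}) (A B : set (T1 * T2)) :
  (forall p, m2 (xsection A p) = m2 (xsection B p)) -> ((m1 \x m2) A = (m1 \x m2) B)%E.
Proof. by move=> AB; apply: eq_integral => p _; exact: AB. Qed.

Lemma lebesgue_measure_cc (a b : R) : a <= b -> (mu `[a, b] = (b - a)%:E)%E.
Proof.
rewrite lebesgue_measure_itv /= lte_fin le_eqVlt => /predU1P[->|->//].
by rewrite ltxx subrr.
Qed.

Lemma lebesgue_measure_shift (a h : R) : mu `[a, a + h] = mu `[0, h].
Proof.
rewrite !lebesgue_measure_itv /= !lte_fin ltrDl; case: ifPn => // _.
by rewrite -!EFinB; congr EFin; ring.
Qed.

(** As [`|X + Y| + `|X - Y|] is twice the larger of [`|X|] and [`|Y|], this is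
    the pyramid of height 2 over the square of side 2 centred at [(u, v)]. *)
Definition pyramid (u v : R) : set (R * R * R) :=
  [set p | 0 <= p.2 /\ `|p.1.1 - u + (p.1.2 - v)| + `|p.1.1 - u - (p.1.2 - v)| + p.2 <= 2].

Lemma measurable_le d (T : measurableType d) (f g : T -> R) :
  measurable_fun setT f -> measurable_fun setT g -> measurable [set p | f p <= g p].
Proof.
move=> mf mg; rewrite -[X in measurable X]setTI.
exact: (measurable_fun_ler mf mg measurableT (Y := [set true])).
Qed.

Lemma measurable_pyramid u v : measurable (pyramid u v).
Proof.
pose f (p : R * R * R) := `|p.1.1 - u + (p.1.2 - v)| + `|p.1.1 - u - (p.1.2 - v)| + p.2.
have m1 : measurable_fun setT (fun p : R * R * R => p.1.1 - u).
  apply: measurable_funB => //.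
  exact: (measurableT_comp measurable_fst measurable_fst).
have m2 : measurable_fun setT (fun p : R * R * R => p.1.2 - v).
  apply: measurable_funB => //.
  exact: (measurableT_comp measurable_snd measurable_fst).
have mf : measurable_fun setT f.
  apply: measurable_funD; last exact: measurable_snd.
  apply: measurable_funD; apply: measurableT_comp => //.
    exact: measurable_funD.
  exact: measurable_funB.
rewrite (_ : pyramid u v = [set p | 0 <= p.2] `&` [set p | f p <= 2]) //.
apply: measurableI.
- exact: (measurable_le (measurable_cst _) measurable_snd).
- exact: (measurable_le mf (measurable_cst _)).
Qed.

Lemma ysection_pyramid u v t :
  (mu \x mu)%E (ysection (pyramid u v) t) =
  (((fun t => ((2 - t) ^+ 2)%:E) \_ `[0%R, 2%R]) t)%E.
Proof.
rewrite patchE; case: ifPn; rewrite (inE, notin_setE) /= in_itv /=.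
  move=> /andP[t0 t2].
  have -> : ysection (pyramid u v) t =
      `[u - (2 - t) / 2, u + (2 - t) / 2] `*` `[v - (2 - t) / 2, v + (2 - t) / 2].
    apply/seteqP; split=> -[x y]; rewrite ysectionE /pyramid /= !in_itv /=.
      move=> [_]; rewrite -lerBrDr square_diagonals !ler_norml => /andP[] *.
      by split; apply/andP; split; lra.
    move=> [/andP[? ?] /andP[? ?]]; split=> //.
    rewrite -lerBrDr square_diagonals !ler_norml.
    by apply/andP; split; apply/andP; split; lra.
  rewrite product_measure1E//.
  rewrite [X in (X * _)%E]lebesgue_measure_cc; last by lra.
  rewrite [X in (_ * X)%E]lebesgue_measure_cc; last by lra.
  by rewrite -EFinM; congr EFin; field.
move/negP; rewrite negb_and -!ltNge => h.
rewrite (_ : ysection _ _ = set0) ?measure0//.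
apply/seteqP; split=> -[x y]; rewrite ysectionE /pyramid //= => -[t0].
have := normr_ge0 (x - u + (y - v)); have := normr_ge0 (x - u - (y - v)).
by case/orP: h; lra.
Qed.

(** A constant of its own, to which the sigma-finite structure is attached. *)
Definition plane_measure := (mu \x mu)%E.

HB.instance Definition _ := Measure.on plane_measure.

Lemma plane_measure_sigma_finite : sigma_finite setT plane_measure.
Proof.
exists (fun n => `[- n%:R, n%:R] `*` `[- n%:R, n%:R]).
  apply/esym/seteqP; split=> // -[x y] _.
  exists (Num.truncn (Num.max `|x| `|y|)).+1 => //.
  have h : Num.max `|x| `|y| <= (Num.truncn (Num.max `|x| `|y|)).+1%:R.
    exact/ltW/truncnS_gt.
  by split=> /=; rewrite in_itv /= -ler_norml (le_trans _ h)// le_max lexx ?orbT.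
move=> n; split; first exact: measurableX.
rewrite /plane_measure product_measure1E//.
have n0 : (- n%:R <= n%:R :> R) by have := ler0n R n; lra.
rewrite [X in (X * _)%E]lebesgue_measure_cc//.
rewrite [X in (_ * X)%E]lebesgue_measure_cc//.
by rewrite ltry.
Qed.

HB.instance Definition _ := Measure_isSigmaFinite.Build _ _ _ plane_measure
  plane_measure_sigma_finite.

Lemma measure_pyramid u v : (((mu \x mu) \x mu) (pyramid u v) = (8 / 3)%:E)%E.
Proof.
apply: etrans; first exact: (product_measure_ysection plane_measure mu (measurable_pyramid u v)).
apply: etrans; first by apply: eq_integral => t _; exact: ysection_pyramid.
by rewrite -integral_mkcond integral_square.
Qed.

(** Over a point at offset [(X, Y)] from the centre, the tetrahedron of the first
    orientation is cut in the heights between [`|X + Y| - 1] and [1 - `|X - Y|],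
    an interval whose length is the height of the pyramid there; reversing the
    orientation exchanges the two absolute values. *)
Lemma volume_tet b w : volume (tet b w) = (8 / 3)%:E.
Proof.
rewrite /volume -(measure_pyramid (w 0 0) (w 0 1)).
apply: product_measure_xsection => -[x y].
set X := x - w 0 0; set Y := y - w 0 1.
pose h := 2 - (`|X + Y| + `|X - Y|).
pose lo := w 0 2%:R - 1 + (if b then `|X - Y| else `|X + Y|).
have -> : xsection (pyramid (w 0 0) (w 0 1)) (x, y) = [set` `[0, h]].
  apply/seteqP; split=> z; rewrite xsectionE /pyramid /h /= in_itv /= -/X -/Y.
    by move=> [? ?]; apply/andP; split; lra.
  by move=> /andP[? ?]; split; lra.
rewrite (_ : xsection _ _ = [set` `[lo, lo + h]]).
  exact: lebesgue_measure_shift.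
apply/seteqP; split=> z; rewrite xsectionE /tet /lo /h /= in_itv /=.
  move/forall_ord4; rewrite !coordE /= -/X -/Y.
  case: b {lo} => /= -[h0 h1 h2 h3];
  by move: h0 h1 h2 h3; case: (ger0P (X + Y)) => ?; case: (ger0P (X - Y)) => ? *;
    apply/andP; split; lra.
move=> hz; apply/forall_ord4; rewrite !coordE /= -/X -/Y.
by case: b {lo} hz => /=; case: (ger0P (X + Y)) => ?;
  case: (ger0P (X - Y)) => ? /andP[? ?]; split; lra.
Qed.

End Volume.

(** * The lattice *)

Section Lattice.
Context {R : realType}.
Local Notation E3 := 'rV[R]_3.
Implicit Types z : 'I_3 -> int.

Definition sqrt10 : R := Num.sqrt 10.

Lemma sqrt10_sqr : sqrt10 ^+ 2 = 10.
Proof. by rewrite sqr_sqrtr. Qed.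

Lemma sqrt10_bounds : 79 / 25 < sqrt10 < 19 / 6.
Proof.
have w0 : 0 <= sqrt10 := sqrtr_ge0 _.
by have e := sqrt10_sqr; apply/andP; split; nra.
Qed.

(* The contacts force [coef_r + 3 * coef_s = 2] and [coef_q = coef_s - coef_r];
   the value of [coef_r] makes the determinant stationary under these relations. *)
Definition coef_r := 2 * sqrt10 - 6.
Definition coef_s := (8 - 2 * sqrt10) / 3.
Definition coef_q := (26 - 8 * sqrt10) / 3.

Definition shift : E3 := vec coef_s (coef_r + coef_s) (- coef_s).

Definition basis : 'M[R]_3 := \matrix_(i < 3)
  [:: vec 2 (- coef_q) 0; vec (- coef_r) 2 (- coef_s); vec (- coef_s) (- coef_r) 2]`_i.

Definition latpt z : E3 := \sum_i (z i)%:~R *: row i basis.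

Lemma latptE z : latpt z = vec
  (2 * (z 0)%:~R - coef_r * (z 1)%:~R - coef_s * (z 2%:R)%:~R)
  (- coef_q * (z 0)%:~R + 2 * (z 1)%:~R - coef_r * (z 2%:R)%:~R)
  (- coef_s * (z 1)%:~R + 2 * (z 2%:R)%:~R).
Proof.
by rewrite /latpt sum_ord3 !rowK; apply: vecP; rewrite !mxE /=; ring.
Qed.

Lemma latpt0 : latpt (fun=> 0) = 0.
Proof. by rewrite /latpt big1// => i _; rewrite scale0r. Qed.

Lemma latptD z z' : latpt z + latpt z' = latpt (fun i => z i + z' i).
Proof. by rewrite -big_split; apply: eq_bigr => i _; rewrite intrD scalerDl. Qed.

Lemma latptN z : - latpt z = latpt (fun i => - z i).
Proof. by rewrite -sumrN; apply: eq_bigr => i _; rewrite intrN scaleNr. Qed.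

Lemma det_basis : \det basis = 16 * (139 - 40 * sqrt10) / 27.
Proof.
rewrite (expand_det_row _ 0) sum_ord3 /cofactor.
rewrite !(expand_det_row _ 0) !big_ord_recl !big_ord0 /cofactor !det_mx11 !mxE /= .
have := sqrt10_sqr; rewrite /coef_r /coef_s /coef_q => e2.
have e3 : sqrt10 ^+ 3 = 10 * sqrt10 by rewrite exprS e2 mulrC.
by rewrite /bump /=; lra.
Qed.

Lemma coef_r_bounds : 0 <= coef_r <= 1 / 3.
Proof.
by have /andP[? ?] := sqrt10_bounds; rewrite /coef_r; apply/andP; split; lra.
Qed.

Lemma coef_s_bounds : 0 <= coef_s <= 4 / 7.
Proof.
by have /andP[? ?] := sqrt10_bounds; rewrite /coef_s; apply/andP; split; lra.
Qed.

Lemma coef_q_bounds : 0 <= coef_q <= 1 / 4.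
Proof.
by have /andP[? ?] := sqrt10_bounds; rewrite /coef_q; apply/andP; split; lra.
Qed.

Lemma ler_norm_comb (a b a' b' A Y T : R) : 0 <= a <= a' -> 0 <= b <= b' ->
  `|A + a * Y + b * T| <= `|A| + a' * `|Y| + b' * `|T|.
Proof.
move=> /andP[a0 aa'] /andP[b0 bb'].
apply: le_trans (ler_normD _ _) _; rewrite lerD//; last first.
  by rewrite normrM (ger0_norm b0) ler_wpM2r.
apply: le_trans (ler_normD _ _) _; rewrite lerD//.
by rewrite normrM (ger0_norm a0) ler_wpM2r.
Qed.

(** The matrix is strictly diagonally dominant, so its inverse does not increase
    the sup norm: in each line the off-diagonal coefficients add up to at most
    [1 / 3 + 4 / 7], and [1 / (2 - 1 / 3 - 4 / 7)] is below [19 / 20]. *)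
Lemma near_twice_identity_bound (r s q K X Y T : R) :
  0 <= r <= 1 / 3 -> 0 <= s <= 4 / 7 -> 0 <= q <= 1 / 4 ->
  `|2 * X - r * Y - s * T| <= K ->
  `|- q * X + 2 * Y - r * T| <= K ->
  `|- s * Y + 2 * T| <= K ->
  [/\ `|X| <= 19 / 20 * K, `|Y| <= 19 / 20 * K & `|T| <= 19 / 20 * K].
Proof.
move=> br bs bq h0 h1 h2.
have nrm2 (A : R) : `|2 * A| = 2 * `|A| by rewrite normrM ger0_norm.
have b0 := ler_norm_comb (2 * X - r * Y - s * T) Y T br bs.
have b1 := ler_norm_comb (- q * X + 2 * Y - r * T) X T bq br.
have b2 := ler_norm_comb (- s * Y + 2 * T) Y 0 bs bs.
have e0 : 2 * X - r * Y - s * T + r * Y + s * T = 2 * X by ring.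
have e1 : - q * X + 2 * Y - r * T + q * X + r * T = 2 * Y by ring.
have e2 : - s * Y + 2 * T + s * Y + s * 0 = 2 * T by ring.
rewrite {}e0 nrm2 in b0; rewrite {}e1 nrm2 in b1; rewrite {}e2 nrm2 normr0 in b2.
move: (normr_ge0 X) (normr_ge0 Y) (normr_ge0 T).
have {b0}b0 := le_trans b0 (lerD (lerD h0 (lexx _)) (lexx _)).
have {b1}b1 := le_trans b1 (lerD (lerD h1 (lexx _)) (lexx _)).
have {b2}b2 := le_trans b2 (lerD (lerD h2 (lexx _)) (lexx _)).
move: `|X| `|Y| `|T| b0 b1 b2; clear => *; split; lra.
Qed.

Lemma latpt_bound (K : R) z :
  `|latpt z 0 0| <= K -> `|latpt z 0 1| <= K -> `|latpt z 0 2%:R| <= K ->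
  [/\ `|(z 0)%:~R| <= 19 / 20 * K, `|(z 1)%:~R| <= 19 / 20 * K
    & `|(z 2%:R)%:~R| <= 19 / 20 * K].
Proof.
rewrite latptE !mxE /=.
exact: (near_twice_identity_bound coef_r_bounds coef_s_bounds coef_q_bounds).
Qed.

Lemma int_norm_lt2 (n : int) : `|n%:~R : R| < 2 -> n \in [:: -1; 0; 1].
Proof. by rewrite -intr_norm -[2]/(2%:~R) ltr_int !inE => h; lia. Qed.

Lemma int_norm_lt3 (n : int) : `|n%:~R : R| < 3 -> n \in [:: -2; -1; 0; 1; 2].
Proof. by rewrite -intr_norm -[3]/(3%:~R) ltr_int !inE => h; lia. Qed.

End Lattice.

(** * Short vectors of the lattice and of its translate by the shift *)

Section ShortVectors.
Context {R : realType}.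
Local Notation E3 := 'rV[R]_3.
Implicit Types z : 'I_3 -> int.

(** A lattice vector in the cube of side 4 has coefficients -1, 0 or 1, by
    [latpt_bound]; of these 27 combinations exactly 15 stay in the cube. *)
Lemma short_latpt_coef z :
  `|latpt z 0 0| <= 2 :> R -> `|latpt z 0 1| <= 2 :> R -> `|latpt z 0 2%:R| <= 2 :> R ->
  (z 0, z 1, z 2%:R) \in
    [:: (0, 0, 0); (1, 0, 0); (0, 1, 0); (0, 0, 1); (0, 1, 1); (1, 0, 1); (1, 1, 0);
     (1, 1, 1); (-1, 0, 0); (0, -1, 0); (0, 0, -1); (0, -1, -1); (-1, 0, -1);
     (-1, -1, 0); (-1, -1, -1)].
Proof.
move=> h0 h1 h2; have [k0 k1 k2] := latpt_bound h0 h1 h2.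
have lt2 (n : int) : `|n%:~R : R| <= 19 / 20 * 2 -> n \in [:: -1; 0; 1].
  by move=> h; apply: (@int_norm_lt2 R); apply: le_lt_trans h _; lra.
move: h0 h1 h2 (lt2 _ k0) (lt2 _ k1) (lt2 _ k2); clear.
rewrite latptE !mxE /= !ler_norml /coef_r /coef_s /coef_q.
have /andP[] := @sqrt10_bounds R; move: sqrt10 => s sl su.
move: (z 0) (z 1) (z 2%:R) => a b c.
move=> /andP[? ?] /andP[? ?] /andP[? ?].
have in3 (n : int) : n \in [:: -1; 0; 1] -> [\/ n = -1, n = 0 | n = 1].
  by rewrite !inE => /or3P[] /eqP ->; [constructor 1|constructor 2|constructor 3].
by do 3!(case/in3 => ?); subst a b c => //; exfalso; lra.
Qed.

(** The origin is the only lattice vector in the open cuboctahedron [T - T].  All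
    fourteen others of [short_latpt_coef] are on its boundary, so each
    of them turns one of the seven strict inequalities into an equality. *)
Lemma short_latpt_eq0 z :
  (forall k, `|latpt z 0 k| < 2 :> R) -> (forall i, `|dot (vtx i) (latpt z)| < 4 :> R) ->
  latpt z = 0 :> E3.
Proof.
move=> h /forall_ord4[d0 d1 d2 d3].
have := short_latpt_coef (ltW (h 0)) (ltW (h 1)) (ltW (h 2%:R)).
move: (h 0) (h 1) (h 2%:R) d0 d1 d2 d3 => {h}.
rewrite latptE /dot !sum_ord3 !mxE /= !ltr_norml /coef_r /coef_s /coef_q.
move: sqrt10 (z 0) (z 1) (z 2%:R) => s a b c h0 h1 h2 d0 d1 d2 d3.
rewrite !inE !xpair_eqE; repeat case/orP; move=> /andP[/andP[/eqP ? /eqP ?] /eqP ?];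
subst a b c; first by apply: vecP; rewrite !mxE /=; lra.
all: exfalso; first
  [ by move/andP: h0; clear => -[*]; lra | by move/andP: h1; clear => -[*]; lra
  | by move/andP: h2; clear => -[*]; lra | by move/andP: d0; clear => -[*]; lra
  | by move/andP: d1; clear => -[*]; lra | by move/andP: d2; clear => -[*]; lra
  | by move/andP: d3; clear => -[*]; lra ].
Qed.

(** These coefficients give the sum of the first two basis vectors, whose images
    under symmetries are controlled by the next lemma. *)
Definition marker z := [/\ z 0 = 1, z 1 = 1 & z 2%:R = 0].

(** The number [(52 - 16 * sqrt10) / 3] is the inner product of that vector with
    [vtx 1]; up to sign no other short lattice vector has such an inner product
    with a vertex direction. *)
Lemma short_latpt_marker z i :
  (forall k, `|latpt z 0 k| <= 2 :> R) ->
  `|dot (vtx i) (latpt z)| = (52 - 16 * sqrt10) / 3 :> R ->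
  marker z \/ marker (fun i => - z i).
Proof.
move=> h; have := short_latpt_coef (h 0) (h 1) (h 2%:R) => {h}.
rewrite latptE /marker /dot !sum_ord3 !mxE /= /coef_r /coef_s /coef_q.
have /andP[] := @sqrt10_bounds R; move: sqrt10 => s sl su.
move: (z 0) (z 1) (z 2%:R) => a b c.
rewrite !inE !xpair_eqE; repeat case/orP; move=> /andP[/andP[/eqP ? /eqP ?] /eqP ?];
subst a b c; try (by left); try (by right);
move: i; apply/forall_ord4; split; rewrite !mxE /=; case: ger0P => _ ?; exfalso; lra.
Qed.

(** The translate of the lattice by the shift avoids the open tetrahedron [2 * T].
    That tetrahedron lies in the cube of side 4, and the shift has coordinates
    at most [1 / 3 + 4 / 7], which bounds the coefficients by 2. *)
Lemma latpt_shift_separated z : exists i,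
  dot (vtx i) (latpt z + shift) <= -2 :> R.
Proof.
apply: contrapT => /forallNP h.
have {h} : forall i, -2 < dot (vtx i) (latpt z + shift) :> R.
  by move=> i; have /negP := h i; rewrite -ltNge.
have /andP[r0 r1] := @coef_r_bounds R; have /andP[s0 s1] := @coef_s_bounds R.
case/forall_ord4; rewrite /shift !coordE /= => h0 h1 h2 h3.
have [] := @latpt_bound R (2 + 1 / 3 + 4 / 7) z.
- by rewrite ler_norml; apply/andP; split; lra.
- by rewrite ler_norml; apply/andP; split; lra.
- by rewrite ler_norml; apply/andP; split; lra.
have lt3 (n : int) : `|n%:~R : R| <= 19 / 20 * (2 + 1 / 3 + 4 / 7) ->
    n \in [:: -2; -1; 0; 1; 2].
  by move=> h; apply: (@int_norm_lt3 R); apply: le_lt_trans h _; lra.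
move=> /lt3 k0 /lt3 k1 /lt3 k2; move: h0 h1 h2 h3 k0 k1 k2; clear.
rewrite latptE !mxE /= /coef_r /coef_s /coef_q.
have /andP[] := @sqrt10_bounds R; move: sqrt10 => s sl su.
move: (z 0) (z 1) (z 2%:R) => a b c h0 h1 h2 h3.
have in5 (n : int) : n \in [:: -2; -1; 0; 1; 2] ->
    n = -2 \/ [\/ n = -1, n = 0, n = 1 | n = 2].
  rewrite !inE => /predU1P[->|]; [by left|move=> h; right; move: h].
  by case/or4P => /eqP ->; [constructor 1|constructor 2|constructor 3|constructor 4].
do 3!(case/in5 => [?|[?|?|?|?]]); subst a b c; first
  [ by move: h0; clear -sl su; lra | by move: h1; clear -sl su; lra
  | by move: h2; clear -sl su; lra | by move: h3; clear -sl su; lra ].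
Qed.

End ShortVectors.

(** * The packing as an orbit of motions *)

Section Packing.
Context {R : realType}.
Local Notation E3 := 'rV[R]_3.
Implicit Types (x y w v : E3) (b : bool) (z : 'I_3 -> int).

(** The centres of the tetrahedra of orientation [b]; the same vectors are
    the translation parts of the symmetries whose linear part is [(-1) ^+ b],
    which makes the packing the orbit of [tet false 0]. *)
Definition site b z : E3 := latpt z + (if b then shift else 0).
Definition motion b v x : E3 := v + (-1) ^+ b *: x.
Definition packing : set (set E3) := [set T | exists b z, T = tet b (site b z)].
Definition motions : set (E3 -> E3) := [set g | exists b z, g = motion b (site b z)].

Lemma motion_comp b v b' v' :
  motion b v \o motion b' v' = motion (b (+) b') (v + (-1) ^+ b *: v').
Proof.
by apply/funext => x; rewrite /motion /= scalerDr scalerA -signr_addb addrA.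
Qed.

Lemma motion_false0 : motion false 0 = id.
Proof. by apply/funext => x; rewrite /motion expr0 scale1r add0r. Qed.

Lemma site_comp b z b' z' :
  exists z'', site b z + (-1) ^+ b *: site b' z' = site (b (+) b') z''.
Proof.
rewrite /site; case: b => /=.
  exists (fun i => z i - z' i); rewrite expr1 scaleN1r opprD addrACA latptN latptD.
  by case: b'; rewrite /= ?subrr ?subr0.
by exists (fun i => z i + z' i); rewrite expr0 scale1r addr0 addrA latptD.
Qed.

Lemma site0 : site false (fun=> 0) = 0.
Proof. by rewrite /site latpt0 addr0. Qed.

Lemma motions_inverse g : motions g -> exists2 h, motions h & g \o h = id /\ h \o g = id.
Proof.
case=> -[] [z ->].
  exists (motion true (site true z)); first by exists true, z.
  by rewrite motion_comp expr1 scaleN1r subrr motion_false0.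
exists (motion false (site false (fun i => - z i))); first by exists false, (fun i => - z i).
rewrite !motion_comp /= expr0 !scale1r /site !addr0 -latptN subrr addNr.
by rewrite motion_false0.
Qed.

Lemma motions_comp g h : motions g -> motions h -> motions (g \o h).
Proof.
move=> [b [z ->]] [b' [z' ->]]; have [z'' e] := site_comp b z b' z'.
by exists (b (+) b'), z''; rewrite motion_comp e.
Qed.

Lemma motion_isometry b v : isometry (motion b v).
Proof.
apply/isometryP => x y; rewrite /motion opprD addrACA subrr add0r -scalerBr.
by rewrite /sqn dotZr dotC dotZr mulrA -expr2 sqrr_sign mul1r.
Qed.

Lemma motion_tet b v b' w :
  motion b v @` tet b' w = tet (b (+) b') (v + (-1) ^+ b *: w).
Proof.
have e x i : (-1) ^+ (b (+) b') * dot (vtx i) (motion b v x - (v + (-1) ^+ b *: w))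
    = (-1) ^+ b' * dot (vtx i) (x - w).
  rewrite /motion opprD addrACA subrr add0r -scalerBr dotZr mulrA -signr_addb.
  by rewrite addbAC addbb.
apply/seteqP; split=> [_ [x xT <-] i|y yT]; first by rewrite e; exact: xT.
exists ((-1) ^+ b *: (y - v)).
  by move=> i; rewrite -e /motion scalerA -expr2 sqrr_sign scale1r subrKC; exact: yT.
by rewrite /motion scalerA -expr2 sqrr_sign scale1r subrKC.
Qed.

Lemma motions_tet g b z : motions g -> exists b' z', g @` tet b (site b z) = tet b' (site b' z').
Proof.
move=> [b' [z' ->]]; rewrite motion_tet; have [z'' ->] := site_comp b' z' b z.
by exists (b' (+) b), z''.
Qed.

Lemma leaves_invariant_motions g : motions g -> leaves_invariant g packing.
Proof.
move=> mg; have [h mh [gh hg]] := motions_inverse mg; split.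
- by move=> _ [b [z ->]]; have [b' [z' ->]] := motions_tet b z mg; exists b', z'.
- move=> T T' _ _ /(congr1 (fun S => h @` S)).
  by rewrite !image_comp hg !image_id.
- move=> _ [b [z ->]]; have [b' [z' e]] := motions_tet b z mh.
  exists (tet b' (site b' z')); first by exists b', z'.
  by rewrite -e image_comp gh image_id.
Qed.

Lemma tet_packing b z : packing (tet b (site b z)).
Proof. by exists b, z. Qed.

(** Every tetrahedron is the image of [tet false 0] by the motion with the same
    parameters. *)
Lemma motions_transitive b z b' z' :
  exists2 g, motions g & g @` tet b (site b z) = tet b' (site b' z').
Proof.
have [h mh [gh hg]] := motions_inverse (ex_intro _ b (ex_intro _ z erefl)).
exists (motion b' (site b' z') \o h); first by apply: motions_comp => //; exists b', z'.
have e b1 z1 : motion b1 (site b1 z1) @` tet false 0 = tet b1 (site b1 z1).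
  by rewrite motion_tet addbF scaler0 addr0.
by rewrite -(e b) image_comp -compA hg; exact: e.
Qed.

End Packing.

(** * The symmetry group of the packing *)

Section Symmetry.
Context {R : realType}.
Local Notation E3 := 'rV[R]_3.
Implicit Types (x y w v : E3) (b : bool) (z : 'I_3 -> int).

Lemma dot_polar x y : dot x y = (sqn x + sqn y - sqn (x - y)) / 2.
Proof. by rewrite /sqn !coordE; field. Qed.

(** Additivity is all the linearity that the sequel needs: the squared norm of
    [f (x + y) - f x - f y] expands into inner products, which [f] preserves. *)
Lemma isometry_linear_part (g : E3 -> E3) : isometry g ->
  {f : E3 -> E3 | [/\ forall x, g x = g 0 + f x, {morph f : x y / x + y}
    & forall x y, dot (f x) (f y) = dot x y]}.
Proof.
move=> /isometryP gi; exists (fun x => g x - g 0).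
have gdot x y : dot (g x - g 0) (g y - g 0) = dot x y.
  by rewrite dot_polar [RHS]dot_polar opprB addrA subrK !gi !subr0.
split=> // [x|x y]; first by rewrite subrKC.
apply/eqP; rewrite -subr_eq0; apply/eqP/sqn_eq0.
move: (gdot (x + y) (x + y)) (gdot (x + y) x) (gdot (x + y) y) (gdot x x) (gdot y y) (gdot x y).
move: (g (x + y) - g 0) (g x - g 0) (g y - g 0) => a p q.
rewrite /sqn !(dotDr, dotNr) !(dotC (a - (p + q))) !(dotDr, dotNr).
by rewrite !(dotC (_ + _)) !(dotDr, dotNr) !(dotC x) !(dotC p) !(dotC q); lra.
Qed.

Definition markpt : E3 := latpt (fun i => [:: 1; 1; 0]`_i).

Lemma markptE : markpt = vec (2 - coef_r) (2 - coef_q) (- coef_s).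
Proof. by rewrite /markpt latptE; apply: vecP; rewrite !mxE /=; ring. Qed.

Lemma marker_latpt z : marker z -> latpt z = markpt.
Proof.
case=> e0 e1 e2; rewrite latptE e0 e1 e2 markptE.
by apply: vecP; rewrite !mxE /=; ring.
Qed.

Lemma dot_vtx_markpt i : dot (vtx i) markpt =
  [:: (4 * sqrt10 - 4) / 3; (52 - 16 * sqrt10) / 3; 4 * sqrt10 - 12; -4]`_i.
Proof.
rewrite markptE /coef_r /coef_q /coef_s; move: sqrt10 => s.
by move: i; apply/forall_ord4; split; rewrite !coordE /=; field.
Qed.

Lemma dot_vtx_markpt_inj i j :
  `|dot (vtx i) markpt| = `|dot (vtx j) markpt| -> i = j.
Proof.
rewrite !dot_vtx_markpt; have /andP[] := @sqrt10_bounds R; move: sqrt10 => s sl su.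
have p0 : 0 < (4 * s - 4) / 3 by lra.
have p1 : 0 < (52 - 16 * s) / 3 by lra.
have p2 : 0 < 4 * s - 12 by lra.
move: i; apply/forall_ord4; split; move: j; apply/forall_ord4; split => //=;
rewrite ?normrN ?(gtr0_norm p0) ?(gtr0_norm p1) ?(gtr0_norm p2) ?normr_nat => h; exfalso; lra.
Qed.

Lemma dot_vtx_markpt_pair i j : i != j ->
  `|dot (vtx i) markpt + dot (vtx j) markpt| <= 4.
Proof.
rewrite !dot_vtx_markpt; have /andP[] := @sqrt10_bounds R; move: sqrt10 => s sl su.
move: i; apply/forall_ord4; split; move: j; apply/forall_ord4; split => //= _;
rewrite ler_norml; apply/andP; split; lra.
Qed.

(** Here [latpt z] is the image of [markpt] under a linear isometry that sends
    [vtx i] to [(-1) ^+ b *: vtx (p i)].  Its coordinates are half sums of two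
    of its inner products with the vertex directions, hence at most 2 in absolute
    value by [dot_vtx_markpt_pair], so it is one of the vectors of
    [short_latpt_coef]; its inner product with [vtx (p 1)] identifies it as
    [markpt] up to sign, and then all four inner products determine [p]. *)
Lemma lattice_markpt z (p : 'I_4 -> 'I_4) b : injective p ->
  (forall i, dot (vtx (p i)) (latpt z) = (-1) ^+ b * dot (vtx i) markpt) -> p =1 id.
Proof.
move=> p_inj e; pose q := invF p_inj.
have eq i : dot (vtx i) (latpt z) = (-1) ^+ b * dot (vtx (q i)) markpt.
  by rewrite -e f_invF.
have n2 k : `|latpt z 0 k| <= 2 :> R.
  have [i [i0 ek]] := coord_dot_vtx (latpt z : E3) k.
  rewrite -(ler_pM2l (ltr0n R 2)) -{1}[2%:R]ger0_norm// -normrM ek !eq.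
  rewrite -mulrDr normrM normrX normrN1 expr1n mul1r.
  have : q 0 != q i by rewrite (inj_eq (can_inj (f_invF p_inj))) eq_sym.
  by move/dot_vtx_markpt_pair; lra.
have abs i : `|dot (vtx (p i)) (latpt z)| = `|dot (vtx i) markpt|.
  by rewrite e normrM normrX normrN1 expr1n mul1r.
have a1 : `|dot (vtx (p 1)) (latpt z)| = (52 - 16 * sqrt10) / 3 :> R.
  rewrite abs dot_vtx_markpt /= ger0_norm//.
  by have /andP[] := @sqrt10_bounds R; move: sqrt10 => s sl su; lra.
have [m|m] := short_latpt_marker n2 a1.
- by move=> i; apply: dot_vtx_markpt_inj; rewrite -{1}(marker_latpt m) abs.
- move=> i; apply: dot_vtx_markpt_inj.
  by rewrite -{1}(marker_latpt m) -latptN dotNr normrN abs.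
Qed.

(** The images of the vertices of [tet false 0] are the corners of a tetrahedron
    of the packing, so the linear part [f] permutes the vertex directions up to
    a common sign.  Comparing with the image of [tet false markpt] shows that
    [f markpt] is in the lattice, and [lattice_markpt] applies. *)
Lemma symmetry_motion (g : E3 -> E3) :
  isometry g -> leaves_invariant g packing -> motions g.
Proof.
move=> gi [gP _ _]; have [f [gf fD fdot]] := isometry_linear_part gi.
have f0 : f 0 = 0 by apply: (addrI (f 0)); rewrite -fD !addr0.
have [b [z gT]] := gP _ (tet_packing false (fun=> 0)).
rewrite site0 in gT.
have cornerE b' w i : corner b' w i = w + (-1) ^+ b' *: vtx i by [].
have vT i : tet false (0 : E3) (vtx i).
  by have := tet_corner false (0 : E3) i; rewrite cornerE expr0 scale1r add0r.
have gv i : tet b (site b z) (g (vtx i)) by rewrite -gT; exists (vtx i).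
have gdist i j : i != j -> sqn (g (vtx i) - g (vtx j)) = 8.
  move=> ij; rewrite (isometryP g).1//.
  by rewrite -(sqn_corner false (0 : E3) ij) !cornerE expr0 !scale1r !add0r.
have /choice[p pE] : forall i, exists j, g (vtx i) = corner b (site b z) j.
  move=> i; have [j ij] : exists j, i != j.
    by have [->|n0] := eqVneq i 0; [exists 1|exists 0].
  by apply: (tet_diameter (gv i) (gv j)); rewrite gdist.
have p_inj : injective p.
  move=> i j e; apply: contrapT => /eqP/gdist; rewrite !pE e subrr /sqn dot0r.
  by move=> /eqP; rewrite eq_sym pnatr_eq0.
have sum_f : \sum_i f (vtx i) = 0.
  by rewrite -(big_morph f fD f0) sum_vtx.
(* Both the vertices and their images are averaged to the centres. *)
have g0 : g 0 = site b z.
  have : \sum_i g (vtx i) = \sum_i corner b (site b z) i.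
    by rewrite [RHS](reindex_inj p_inj); apply: eq_bigr => i _; exact: pE.
  under eq_bigr do rewrite gf.
  rewrite /corner !big_split /= sum_f addr0 -scaler_sumr sum_vtx scaler0 addr0.
  rewrite !sumr_const card_ord.
  rewrite -mulrnDl -/(site b z) => e4.
  by apply/rowP => k; move/rowP/(_ k): e4; rewrite !mulmxnE; lra.
have fv i : f (vtx i) = (-1) ^+ b *: vtx (p i).
  by have := gf (vtx i); rewrite pE g0 cornerE => /addrI <-.
have [b' [z' gT']] := gP _ (tet_packing false (fun i => [:: 1; 1; 0]`_i)).
rewrite {1}/site addr0 -/markpt in gT'.
have [bb' wE] : b = b' /\ site b z + f markpt = site b' z'.
  apply: tet_corner_inj => i; rewrite -gT'; exists (markpt + vtx (invF p_inj i)).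
    by have := tet_corner false markpt (invF p_inj i); rewrite cornerE expr0 scale1r.
  by rewrite gf fD fv f_invF g0 addrA.
have fm : f markpt = latpt (fun i => z' i - z i).
  apply/rowP => k; move/rowP/(_ k): wE.
  by rewrite -bb' -latptD -latptN /site !mxE; lra.
have p_id : p =1 id.
  apply: (lattice_markpt (b := b) p_inj (z := fun i => z' i - z i)) => i; rewrite -fm.
  have := fdot (vtx i) markpt; rewrite fv dotC dotZr dotC => <-.
  by rewrite mulrA -expr2 sqrr_sign mul1r.
exists b, z; apply/funext => x; rewrite gf g0 /motion; congr (_ + _).
apply: dot_vtx_inj => i.
have := fdot (vtx i) x; rewrite fv p_id dotC dotZr dotC => e.
by rewrite dotZr -e mulrA -expr2 sqrr_sign mul1r.
Qed.

End Symmetry.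

(** * Interiors, density and space group *)

Section Conclusions.
Context {R : realType}.
Local Notation E3 := 'rV[R]_3.
Implicit Types (x y w v : E3) (b : bool) (z : 'I_3 -> int).

Lemma packing_disjoint (T T' : set E3) : packing T -> packing T' -> T <> T' ->
  interior T `&` interior T' = set0.
Proof.
have same b z z' : tet b (site b z) <> tet b (site b z') :> set E3 ->
    interior (tet b (site b z)) `&` interior (tet b (site b z')) = set0 :> set E3.
  move=> ne; apply: same_orientation_disjoint; apply: contrapT => /not_orP[h1 h2].
  have e : site b z' - site b z = latpt (fun i => z' i - z i) :> E3.
    by rewrite /site opprD addrACA subrr addr0 latptN latptD.
  apply: ne; congr tet; apply/esym/eqP; rewrite -subr_eq0 e; apply/eqP.
  apply: short_latpt_eq0 => [k|i]; rewrite -e ltNge; apply/negP => h.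
    by apply: h1; exists k.
  by apply: h2; exists i.
have opp z z' : interior (tet false (site false z)) `&`
    interior (tet true (site true z')) = set0 :> set E3.
  apply: opposite_orientation_disjoint.
  have [i h] := @latpt_shift_separated R (fun i => z' i - z i); exists i; move: h.
  by rewrite -latptD -latptN /site addr0 [latpt z' + _ - _]addrAC.
move=> [[] [z ->]] [[] [z' ->]] //.
- exact: same.
- by move=> _; rewrite setIC.
- exact: same.
Qed.

Lemma packing_tetrahedra : tetrahedron_packing (@packing R).
Proof.
split; last exact: packing_disjoint.
- by move=> _ [b [z ->]]; exact: tet_regular.
- move=> _ _ [b [z ->]] [b' [z' ->]].
  have [g [c [t ->]] e] := @motions_transitive R b z b' z'.
  by exists (motion c (site c t)); [exact: motion_isometry|rewrite e].
Qed.

Lemma translationE v : translation v = motion false v.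
Proof. by apply/funext => x; rewrite /translation /motion scale1r addrC. Qed.

Lemma translations_packing : translations (@packing R) = [set latpt z | z in setT].
Proof.
apply/seteqP; split=> [v [vP _ _]|_ [z _ <-]].
  have [b [z]] := vP _ (tet_packing false (fun=> 0)).
  rewrite translationE motion_tet site0 scaler0 addr0 => /tet_inj[<-] ->.
  by exists z; rewrite // /site addr0.
rewrite /translations /= translationE; apply: leaves_invariant_motions.
by exists false, z; rewrite /site addr0.
Qed.

(* The covolume is a positive multiple of this number. *)
Lemma conjugate_gt0 : 139 - 40 * sqrt10 > 0 :> R.
Proof. by have /andP[_ h] := @sqrt10_bounds R; lra. Qed.

Lemma basis_translations : lattice_basis basis (translations (@packing R)).
Proof.
split; last by rewrite translations_packing.
by rewrite unitmxE unitfE det_basis; apply: lt0r_neq0; have := conjugate_gt0; lra.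
Qed.

Definition orientation_orbit b : set (set E3) := [set T | exists z, T = tet b (site b z)].

Lemma translation_orbitE b z :
  [set translation v @` tet b (site b z) | v in translations packing] = orientation_orbit b.
Proof.
have e t : translation (latpt t) @` tet b (site b z) =
    tet b (site b (fun i => t i + z i)) :> set E3.
  by rewrite translationE motion_tet scale1r /site -latptD addrA.
rewrite translations_packing; apply/seteqP; split=> [_ [_ [t _ <-] <-]|_ [t ->]].
  by eexists; exact: e.
exists (latpt (fun i => t i - z i)); first by exists (fun i => t i - z i).
by rewrite e; congr (tet b (site b _)); apply/funext => i; rewrite subrK.
Qed.

Lemma translation_orbits_packing :
  translation_orbits packing = (fun n => orientation_orbit (n == 1%N)) @` `I_2.
Proof.
apply/seteqP; split=> [_ [_ [b [z ->]] <-]|_ [n _ <-]].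
  by rewrite translation_orbitE; exists (nat_of_bool b); case: b.
exists (tet (n == 1%N) (site (n == 1%N) (fun=> 0))); first by exists (n == 1%N), (fun=> 0).
exact: translation_orbitE.
Qed.

Lemma orientation_orbit_inj b b' : orientation_orbit b = orientation_orbit b' -> b = b'.
Proof.
move=> e; have : orientation_orbit b (tet b (site b (fun=> 0))) by exists (fun=> 0).
by rewrite e => -[z /tet_inj[]].
Qed.

Lemma packing_unit_cell : unit_cell_contains (@packing R) 2.
Proof.
rewrite /unit_cell_contains translation_orbits_packing; apply: inj_card_eq => m n.
rewrite !inE /= => m2 n2 /orientation_orbit_inj.
by case: m m2 => [|[|//]]; case: n n2 => [|[|//]].
Qed.

Lemma packing_periodic : periodic (@packing R).
Proof.
split; first by exists basis; exact: basis_translations.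
by rewrite translation_orbits_packing; apply: finite_image; exact: finite_II.
Qed.

Lemma packing_density : packing_fraction packing ((139 + 40 * sqrt10) / 369 : R).
Proof.
exists 2, (8 / 3), basis; split.
- exact: packing_unit_cell.
- by move=> _ [b [z ->]]; exact: volume_tet.
- exact: basis_translations.
- have h := conjugate_gt0; rewrite det_basis ger0_norm; last by lra.
  have e : (139 + 40 * sqrt10) * (139 - 40 * sqrt10) = 3321 :> R.
    by have := @sqrt10_sqr R => e2; lra.
  have -> : (139 + 40 * sqrt10) = 3321 / (139 - 40 * sqrt10) :> R.
    by rewrite -e mulfK//; exact: lt0r_neq0.
  by field; exact: lt0r_neq0.
Qed.

Lemma symmetry_group_packing : symmetry_group (@packing R) = motions.
Proof.
apply/seteqP; split=> g; first by case; exact: symmetry_motion.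
move=> gm; split; last exact: leaves_invariant_motions.
by case: gm => b [z ->]; exact: motion_isometry.
Qed.

Lemma motions_group : isometry_group (@motions R).
Proof.
split.
- by move=> _ [b [z ->]]; exact: motion_isometry.
- by exists false, (fun=> 0); rewrite site0 motion_false0.
- exact: motions_comp.
- move=> g /motions_inverse[h hm [gh hg]]; exists h => //; split=> x.
    by rewrite -[LHS]/((h \o g) x) hg.
  by rewrite -[LHS]/((g \o h) x) gh.
Qed.

(** The centre of inversion is the midpoint between the centres of [tet false 0]
    and [tet true shift]; every other motion reversing the orientation is this
    inversion followed by a lattice translation. *)
Lemma motions_P1bar : space_group_P1bar (@motions R).
Proof.
exists (translations packing), (2^-1 *: shift).
split; first by exists basis; exact: basis_translations.
have inv_motion z : motion true (site true z) =
    translation (latpt z) \o inversion (2^-1 *: shift) :> (E3 -> E3).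
  apply/funext => x; rewrite /motion /translation /inversion /= scalerA divff ?pnatr_eq0//.
  by rewrite scale1r expr1 scaleN1r /site -addrA [LHS]addrC.
rewrite translations_packing; apply/seteqP; split=> [g gm|g].
- move=> G [[_ _ Gcomp _] GS].
  case: gm => -[] [z ->].
    rewrite inv_motion; apply: Gcomp; apply: GS; [left|right] => //.
    by exists (latpt z) => //; exists z.
  apply: GS; left; exists (latpt z); first by exists z.
  by rewrite translationE /site addr0.
- apply; split; first exact: motions_group.
  move=> _ [[_ [z _ <-] <-]|->].
    by exists false, z; rewrite translationE /site addr0.
  exists true, (fun=> 0); rewrite inv_motion latpt0.
  by apply/funext => x; rewrite /translation /= addr0.
Qed.

Lemma packing_transitive : acts_transitively motions (@packing R).
Proof. by move=> _ _ [b [z ->]] [b' [z' ->]]; exact: motions_transitive. Qed.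

End Conclusions.

Theorem theorem2 (R : realType) :
  exists P : set (set 'rV[R]_3),
    tetrahedron_packing P /\
    (periodic P /\ packing_fraction P ((139 + 40 * Num.sqrt 10) / 369)) /\
    unit_cell_contains P 2 /\
    (space_group_P1bar (symmetry_group P) /\
     acts_transitively (symmetry_group P) P).
Proof.
exists packing; rewrite symmetry_group_packing; split; first exact: packing_tetrahedra.
split; first by split; [exact: packing_periodic|exact: packing_density].
by split; [exact: packing_unit_cell|split; [exact: motions_P1bar|exact: packing_transitive]].
Qed.
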